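(* Let $n\ge 2$ and $k\ge 2$ be integers, let $\sigma=1$, let $m_1,\dots,m_n>0$ be given masses and let $T(t)$ be a given admissible matrix for $\sigma=1$. For $\epsilon>0$ let $R_{\epsilon,T,m_1,\dots,m_n}$ be the set of all relative equilibria $q_i(t)=T(t)Q_i$, $i\in\{1,\dots,n\}$, with matrix $T(t)$ and masses $m_1,\dots,m_n$, of the curved $n$-body problem with $\sigma=1$ for which $\langle Q_i,Q_j\rangle>-1+\epsilon$ for all $i,j\in\{1,\dots,n\}$, $i\ne j$. Then for all $\epsilon>0$ there exists a constant $c_\epsilon>0$ such that for any relative equilibrium in $R_{\epsilon,T,m_1,\dots,m_n}$ we have $\|q_i(t)-q_j(t)\|>c_\epsilon$ for all $t$ and all $i,j\in\{1,\dots,n\}$, $i\neq j$.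
   Context: $\|\cdot\|$ and $\langle\cdot,\cdot\rangle$ are the Euclidean norm and inner product on $\mathbb{R}^{k+1}$. For $\sigma\in\{+1,-1\}$ let $$\mathbb{M}_\sigma^k=\{(x_1,\dots,x_{k+1})\in\mathbb{R}^{k+1}\mid x_1^2+\dots+x_k^2+\sigma x_{k+1}^2=\sigma\},$$ and $x\odot y=x_1y_1+\dots+x_ky_k+\sigma x_{k+1}y_{k+1}$. (For $\sigma=1$, $\mathbb{M}_\sigma^k$ is the unit sphere and $\odot$ is the Euclidean inner product.) Curved $n$-body problem: for point particles with masses $m_1,\dots,m_n$ and positions $q_1,\dots,q_n\in\mathbb{M}_\sigma^k$, the system $$\ddot q_i=\sum_{j=1,\ j\neq i}^n\frac{m_j\big(q_j-\sigma(q_i\odot q_j)q_i\big)}{\big(\sigma-\sigma(q_i\odot q_j)^2\big)^{3/2}}-\sigma(\dot q_i\odot\dot q_i)q_i,\qquad i\in\{1,\dots,n\}.$$ Admissible matrix for $\sigma$: a twice differentiable time-dependent invertible real $(k+1)\times(k+1)$ matrix $T(t)$ ($t$ in a nonempty open time interval) such that (i) there exist constants $c_1,c_2\in\mathbb{R}_{>0}$ with $c_1\|x\|\le\|T(t)^{-1}\ddot T(t)x\|\le c_2\|x\|$ for all $x\in\mathbb{R}^{k+1}$ and all $t$; (ii) $(T(t)x)\odot(T(t)y)=x\odot y$ for all $x,y\in\mathbb{M}_\sigma^k$ and all $t$; (iii) $\|\dot T(t)x\|$ is bounded if $x$ is bounded (i.e. for each $t$ and each bounded set $S$, $\sup_{x\in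 S}\|\dot T(t)x\|<\infty$). Relative equilibrium with matrix $T(t)$ and masses $m_1,\dots,m_n$: a solution $q_1(t),\dots,q_n(t)\in\mathbb{M}_\sigma^k$ of the curved $n$-body problem (in particular all denominators are defined and nonzero, so $q_i(t)\neq\pm q_j(t)$ for $i\ne j$) of the form $q_i(t)=T(t)Q_i$, $i\in\{1,\dots,n\}$, with constant vectors $Q_1,\dots,Q_n\in\mathbb{R}^{k+1}$. *)

(* Defs.v *)
From HB Require Import structures.
From mathcomp Require Import all_boot all_order all_algebra.
From mathcomp Require Import all_classical all_reals all_analysis.
Set Implicit Arguments.
Unset Strict Implicit.
Unset Printing Implicit Defensive.
Import Order.TTheory GRing.Theory Num.Theory.
Import numFieldNormedType.Exports.
Local Open Scope ring_scope.
Local Open Scope classical_set_scope.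

(* The library norm [`|x|] on matrices is the max norm, hence the explicit
   Euclidean inner product and norm. *)
Definition edot (R : realType) (d : nat) (x y : 'cV[R]_d) : R :=
  \sum_(i < d) x i 0 * y i 0.

Definition enorm (R : realType) (d : nat) (x : 'cV[R]_d) : R :=
  Num.sqrt (edot x x).

(* Throughout, [sigma] is meant to be 1 or -1.  The coordinates x_1, ..., x_k
   are those of index [widen_ord (leqnSn k) i], and x_{k+1} has index
   [ord_max]. *)
Definition Mspace (R : realType) (k : nat) (sigma : R) : set 'cV[R]_k.+1 :=
  [set x | \sum_(i < k) x (widen_ord (leqnSn k) i) 0 ^+ 2
           + sigma * x ord_max 0 ^+ 2 = sigma].

Definition odot (R : realType) (k : nat) (sigma : R) (x y : 'cV[R]_k.+1) : R :=
  \sum_(i < k) x (widen_ord (leqnSn k) i) 0 * y (widen_ord (leqnSn k) i) 0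
  + sigma * x ord_max 0 * y ord_max 0.

(* For [I] open, this and the values on [I] of the first two derivatives of [f]
   depend only on the restriction of [f] to [I]. *)
Definition twice_derivable_on (R : realType) (V : normedModType R)
    (I : set R) (f : R -> V) : Prop :=
  forall t, I t -> derivable f t 1 /\ derivable (derive1 f) t 1.

Definition open_time_interval (R : realType) (I : set R) : Prop :=
  [/\ open I, is_interval I & I !=set0].

(* The base of the power 3/2 in the denominators of the equations of motion. *)
Definition nbody_den (R : realType) (k : nat) (sigma : R)
    (x y : 'cV[R]_k.+1) : R :=
  sigma - sigma * odot sigma x y ^+ 2.

Definition nbody_rhs (R : realType) (n k : nat) (sigma : R) (m : 'I_n -> R)
    (q : 'I_n -> R -> 'cV[R]_k.+1) (i : 'I_n) (t : R) : 'cV[R]_k.+1 :=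
  \sum_(j < n | j != i)
     (m j / nbody_den sigma (q i t) (q j t) `^ (3 / 2)) *:
       (q j t - (sigma * odot sigma (q i t) (q j t)) *: q i t)
  - (sigma * odot sigma (derive1 (q i) t) (derive1 (q i) t)) *: q i t.

(* [0 < nbody_den _ _ _] says that the denominators are defined and nonzero;
   [powR] and division are total, so this has to be required separately. *)
Definition curved_nbody_solution (R : realType) (n k : nat) (sigma : R)
    (m : 'I_n -> R) (I : set R) (q : 'I_n -> R -> 'cV[R]_k.+1) : Prop :=
  [/\ forall i, twice_derivable_on I (q i),
      forall i t, I t -> Mspace sigma (q i t),
      forall i j t, I t -> j != i -> 0 < nbody_den sigma (q i t) (q j t)
    & forall i t, I t -> derive1n 2 (q i) t = nbody_rhs sigma m q i t].

Definition admissible (R : realType) (k : nat) (sigma : R) (I : set R)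
    (T : R -> 'M[R]_k.+1) : Prop :=
  [/\ open_time_interval I,
      twice_derivable_on I T /\ (forall t, I t -> T t \in unitmx),
      exists c1 c2 : R, [/\ 0 < c1, 0 < c2 &
        forall t (x : 'cV[R]_k.+1), I t ->
          c1 * enorm x <= enorm (invmx (T t) *m derive1n 2 T t *m x) <= c2 * enorm x],
      forall t (x y : 'cV[R]_k.+1), I t -> Mspace sigma x -> Mspace sigma y ->
        odot sigma (T t *m x) (T t *m y) = odot sigma x y
    & forall t (S : set 'cV[R]_k.+1), I t ->
        has_ubound [set enorm x | x in S] ->
        has_ubound [set enorm (derive1 T t *m x) | x in S]].

Definition relative_equilibrium (R : realType) (n k : nat) (sigma : R)
    (m : 'I_n -> R) (I : set R) (T : R -> 'M[R]_k.+1)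
    (Q : 'I_n -> 'cV[R]_k.+1) (q : 'I_n -> R -> 'cV[R]_k.+1) : Prop :=
  curved_nbody_solution sigma m I q /\
  forall i t, I t -> q i t = T t *m Q i.

(* The set R_{eps,T,m_1,...,m_n}, for sigma = 1. *)
Definition releq_set (R : realType) (n k : nat) (m : 'I_n -> R) (I : set R)
    (T : R -> 'M[R]_k.+1) (eps : R) : set ('I_n -> R -> 'cV[R]_k.+1) :=
  [set q | exists Q : 'I_n -> 'cV[R]_k.+1,
     relative_equilibrium 1 m I T Q q /\
     forall i j, i != j -> edot (Q i) (Q j) > -1 + eps].

(* Main.v *)
Require Import Defs.
From HB Require Import structures.
From mathcomp Require Import all_boot all_order all_algebra.
From mathcomp Require Import all_classical all_reals all_analysis.
From mathcomp Require Import ring lra.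
Set Implicit Arguments.
Unset Strict Implicit.
Unset Printing Implicit Defensive.
Import Order.TTheory GRing.Theory Num.Theory.
Import numFieldNormedType.Exports.
Local Open Scope ring_scope.
Local Open Scope classical_set_scope.

(* An admissible T(t) is orthogonal, so the bound on T^-1 T'' bounds q_i'', its
   component |q_i'|^2 along -q_i, and hence the gravitational force F_i on each
   particle, uniformly over all relative equilibria.  For c = <q_i, q_j> one has
     m_i F_ij + m_j F_ji = m_i m_j (1 - c) (q_i + q_j) / (1 - c^2)^(3/2),
   so on the sphere internal forces do not cancel: the total internal force of a
   tight cluster points towards it and blows up like the inverse of its smallest
   distance.  If the cluster is well separated from the other particles, and
   near-antipodal pairs are excluded, the external forces stay bounded, so this is
   impossible.  Going through n nested scales around a particle, some consecutive
   pair of scales encloses the same particles, which gives such a cluster. *)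

(** * Derivatives of a moving matrix times a constant one *)

Lemma is_derive_mulmxr (R : realType) (p q r : nat)
    (M : R -> 'M[R]_(p.+1, q.+1)) (x : 'M[R]_(q.+1, r.+1)) (t : R) :
  derivable M t 1 -> is_derive t 1 (fun s => M s *m x) (derive1 M t *m x).
Proof.
move=> dM; have dMe i j : derivable (fun s => M s i j) t 1.
  by move/derivable_mxP : dM.
have entryE i j : (fun s => (M s *m x) i j) =
    \sum_(l < q.+1) (x l j *: (fun s => M s i l)).
  by apply/funext => s; rewrite mxE fct_sumE; apply: eq_bigr => l _ /=; rewrite mulrC.
have dE i j : derivable (fun s => (M s *m x) i j) t 1.
  by rewrite entryE; apply: derivable_sum => l; exact: derivableZ.
have dMx : derivable (fun s => M s *m x) t 1 by apply/derivable_mxP.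
apply: DeriveDef => //; rewrite derive_mx// derive1E derive_mx//.
apply/matrixP => i j; rewrite !mxE entryE derive_sum; last first.
  by move=> l; exact: derivableZ.
by apply: eq_bigr => l _; rewrite deriveZ// mxE mulrC.
Qed.

Lemma near_eq_derive1 (R : realType) (V : normedModType R) (f g : R -> V) (t : R) :
  (\near t, f t = g t) -> derive1 f t = derive1 g t.
Proof. by move=> fg; rewrite !derive1E; exact: near_eq_derive. Qed.

(** [f] is prescribed only on [I]; openness gives agreement near each point, which differentiation
    needs. *)
Lemma derive1n2_mulmxr (R : realType) (p q r : nat) (I : set R)
    (M : R -> 'M[R]_(p.+1, q.+1)) (x : 'M[R]_(q.+1, r.+1))
    (f : R -> 'M[R]_(p.+1, r.+1)) :
  open I -> twice_derivable_on I M -> (forall t, I t -> f t = M t *m x) ->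
  forall t, I t -> derive1n 2 f t = derive1n 2 M t *m x.
Proof.
move=> oI dM fE t It.
have nearI (s : R) : I s -> \forall u \near s, I u by move=> Is; exact: open_nbhs_nbhs.
have f'E s : I s -> derive1 f s = derive1 M s *m x.
  move=> Is; rewrite (@near_eq_derive1 _ _ f (fun u => M u *m x)).
    by rewrite derive1E; apply: derive_val; apply: is_derive_mulmxr; case: (dM s Is).
  by near=> u; apply: fE; near: u; exact: nearI.
rewrite /derive1n /= (@near_eq_derive1 _ _ _ (fun u => derive1 M u *m x)).
  by rewrite derive1E; apply: derive_val; apply: is_derive_mulmxr; case: (dM t It).
by near=> u; apply: f'E; near: u; exact: nearI.
Unshelve. all: by end_near. Qed.

(** * Euclidean inner product, sphere and isometries *)

Lemma edotE (R : realType) (d : nat) (x y : 'cV[R]_d) : edot x y = (x^T *m y) 0 0.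
Proof. by rewrite mxE; apply: eq_bigr => i _; rewrite mxE. Qed.

Lemma edotC (R : realType) (d : nat) (x y : 'cV[R]_d) : edot x y = edot y x.
Proof. by apply: eq_bigr => i _; rewrite mulrC. Qed.

Lemma edotDl (R : realType) (d : nat) (x y z : 'cV[R]_d) :
  edot (x + y) z = edot x z + edot y z.
Proof. by rewrite /edot -big_split; apply: eq_bigr => i _; rewrite mxE mulrDl. Qed.

Lemma edotZl (R : realType) (d : nat) a (x z : 'cV[R]_d) :
  edot (a *: x) z = a * edot x z.
Proof. by rewrite /edot mulr_sumr; apply: eq_bigr => i _; rewrite mxE mulrA. Qed.

Lemma edotBl (R : realType) (d : nat) (x y z : 'cV[R]_d) :
  edot (x - y) z = edot x z - edot y z.
Proof. by rewrite -scaleN1r edotDl edotZl mulN1r. Qed.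

Lemma edotZr (R : realType) (d : nat) a (x z : 'cV[R]_d) :
  edot x (a *: z) = a * edot x z.
Proof. by rewrite edotC edotZl edotC. Qed.

Lemma edotBr (R : realType) (d : nat) (x y z : 'cV[R]_d) :
  edot x (y - z) = edot x y - edot x z.
Proof. by rewrite edotC edotBl !(edotC x). Qed.

Lemma edot_suml (R : realType) (d : nat) (J : Type) (s : seq J) (P : pred J)
    (x : J -> 'cV[R]_d) (z : 'cV[R]_d) :
  edot (\sum_(j <- s | P j) x j) z = \sum_(j <- s | P j) edot (x j) z.
Proof.
elim/big_rec2: _ => [|j u v _ <-]; last by rewrite edotDl.
by rewrite /edot big1// => i _; rewrite mxE mul0r.
Qed.

Lemma edot_ge0 (R : realType) (d : nat) (x : 'cV[R]_d) : 0 <= edot x x.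
Proof. by apply: sumr_ge0 => i _; rewrite -expr2 sqr_ge0. Qed.

Lemma edot_subsq (R : realType) (d : nat) (x y : 'cV[R]_d) :
  edot (x - y) (x - y) = edot x x + edot y y - 2 * edot x y.
Proof. by rewrite edotBl !edotBr [edot y x]edotC; ring. Qed.

(** Cauchy-Schwarz, from the squared length of [x - edot x y *: y]. *)
Lemma edot_le (R : realType) (d : nat) (x y : 'cV[R]_d) (K : R) :
  0 <= K -> edot x x <= K ^+ 2 -> edot y y = 1 -> `|edot x y| <= K.
Proof.
move=> K0 xK y1; have := edot_ge0 (x - edot x y *: y).
rewrite edot_subsq !edotZl !edotZr y1 => h.
rewrite -[leRHS](ger0_norm K0) -ler_sqr ?nnegrE// !real_normK ?num_real//.
by apply: le_trans xK; lra.
Qed.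

(* The squared chord of a unit sphere is [2 (1 - <x, y>)]; this is the
   parallelogram inequality for chords. *)
Lemma edot_unit_triangle (R : realType) (d : nat) (x y z : 'cV[R]_d) :
  edot x x = 1 -> edot y y = 1 -> edot z z = 1 ->
  1 - edot y z <= 2 * (1 - edot x y) + 2 * (1 - edot x z).
Proof.
move=> x1 y1 z1; have := edot_ge0 ((x - y) - (z - x)).
rewrite !edotBl !edotBr x1 y1 z1.
rewrite [edot y x]edotC [edot z x]edotC [edot z y]edotC => h.
by lra.
Qed.

Lemma odot1E (R : realType) (k : nat) (x y : 'cV[R]_k.+1) : odot 1 x y = edot x y.
Proof. by rewrite /odot /edot big_ord_recr mul1r. Qed.

Lemma Mspace1E (R : realType) (k : nat) (x : 'cV[R]_k.+1) :
  Mspace 1 x <-> edot x x = 1.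
Proof.
rewrite -odot1E /Mspace/= /odot !mul1r expr2.
by under [X in _ <-> X + _ = _]eq_bigr do rewrite -expr2.
Qed.

(** The standard basis vectors lie on the sphere, and their images are the columns of [A]. *)
Lemma isometry_trmx_mul (R : realType) (k : nat) (A : 'M[R]_k.+1) :
  (forall x y, Mspace 1 x -> Mspace 1 y -> odot 1 (A *m x) (A *m y) = odot 1 x y) ->
  A^T *m A = 1%:M.
Proof.
move=> isoA; have deltaE (i j : 'I_k.+1) : edot (delta_mx i 0) (delta_mx j 0) = (i == j)%:R :> R.
  rewrite edotE trmx_delta mul_delta_mx_cond.
  by case: eqP => _; rewrite mxE ?eqxx.
have Mdelta i : Mspace 1 (delta_mx i 0 : 'cV[R]_k.+1).
  by apply/Mspace1E; rewrite deltaE eqxx.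
apply/matrixP => i j; have := isoA _ _ (Mdelta i) (Mdelta j).
rewrite !odot1E deltaE => dotE; rewrite [LHS]mxE [RHS]mxE -dotE.
by apply: eq_bigr => l _; rewrite -!colE !mxE.
Qed.

Lemma edot_isometry (R : realType) (k : nat) (A : 'M[R]_k.+1) :
  A^T *m A = 1%:M -> forall x y : 'cV[R]_k.+1, edot (A *m x) (A *m y) = edot x y.
Proof.
by move=> AA x y; rewrite !edotE trmx_mul mulmxA -(mulmxA x^T) AA mulmx1.
Qed.

(** * Separation of points under bounded forces *)

Lemma pos_lower_bound (R : realType) (n : nat) (m : 'I_n -> R) :
  (forall i, 0 < m i) -> exists2 mu, 0 < mu & forall i, mu <= m i.
Proof.
move=> m0; exists (\big[Num.min/1]_i m i); first exact: lt_bigmin.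
by move=> i; exact: bigmin_le.
Qed.

Lemma ler_sum_cond (R : realType) (J : finType) (P : pred J) (f : J -> R) :
  (forall i, 0 <= f i) -> \sum_(i | P i) f i <= \sum_i f i.
Proof. by move=> f0; rewrite [leRHS](bigID P)/= lerDl sumr_ge0. Qed.

(** Exchanging [i] and [j] turns [w i j * c i j * x i] into [w i j * c i j * x j]. *)
Lemma symmetric_force_sum (R : realType) (J : finType) (P : pred J)
    (w c : J -> J -> R) (x : J -> R) :
  (forall i j, w i j = w j i) -> (forall i j, c i j = c j i) ->
  \sum_(i | P i) \sum_(j | P j) w i j * (x j - c i j * x i) =
  \sum_(i | P i) \sum_(j | P j) w i j * (1 - c i j) * x j.
Proof.
move=> wC cC.
have swap : \sum_(i | P i) \sum_(j | P j) w i j * c i j * x i =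
            \sum_(i | P i) \sum_(j | P j) w i j * c i j * x j.
  by rewrite exchange_big; do 2![apply: eq_bigr => ? _]; rewrite wC cC.
transitivity (\sum_(i | P i) (\sum_(j | P j) w i j * (1 - c i j) * x j +
    (\sum_(j | P j) w i j * c i j * x j - \sum_(j | P j) w i j * c i j * x i))).
  apply: eq_bigr => i _; rewrite -sumrB -big_split/=.
  by apply: eq_bigr => j _; ring.
by rewrite big_split/= sumrB swap subrr addr0.
Qed.

(* Everything the cluster argument uses about the points is in their Gram matrix
   [c].  The fourth clause is the triangle inequality for squared chords, and the
   last one bounds the component of the force on [i] along the position of [a];
   its term [j = i], where the denominator is 0, vanishes as [c j a - c i j * c i a]. *)
Definition bounded_force_gram (R : realType) (n : nat) (m : 'I_n -> R)
    (eps K : R) (c : 'I_n -> 'I_n -> R) : Prop :=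
  [/\ forall i, c i i = 1,
      forall i j, c i j = c j i,
      forall i j, i != j -> -1 + eps < c i j < 1,
      forall i j a, 1 - c j a <= 2 * (1 - c i j) + 2 * (1 - c i a)
    & forall i a, `|\sum_j m j / (1 - c i j ^+ 2) `^ (3 / 2) *
                    (c j a - c i j * c i a)| <= K].

Lemma powR32E (R : realType) (D : R) : 0 <= D -> D `^ (3 / 2) = D * Num.sqrt D.
Proof.
move=> D0; have -> : 3 / 2 = 1 + 2^-1 :> R by field.
rewrite powRD ?powRr1 ?powR12_sqrt//.
by apply/implyP => /eqP; lra.
Qed.

(* If no point lies between the scales [r] and [rho] around [a], the points near
   [a] form an isolated cluster.  Along the position of [a], the forces between
   its members add up, pair by pair, with the same sign and blow up with the
   closest pair, while the forces from outside are bounded in terms of [rho]. *)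
Lemma cluster_gap (R : realType) (n : nat) (m : 'I_n -> R) (eps K rho : R) :
  (forall i, 0 < m i) -> 0 < eps -> 0 <= K -> 0 < rho ->
  exists r, [/\ 0 < r, r <= rho & forall c a, bounded_force_gram m eps K c ->
    (forall i, 1 - c i a < rho -> 1 - c i a < r) ->
    forall b, b != a -> r <= 1 - c b a].
Proof.
move=> m0 eps0 K0 rho0.
have [mu mu0 mum] := pos_lower_bound m0.
pose M := \sum_i m i.
have M0 : 0 <= M by apply: sumr_ge0 => i _; exact: ltW.
(* Lower bound for [(1 - c i j) * (1 + c i j)] with [i] in the cluster and [j] outside. *)
pose delta := rho / 4 * eps.
have delta0 : 0 < delta by rewrite mulr_gt0// divr_gt0.
(* Bound for the internal forces: total force plus external contribution. *)
pose B := M * K + M * M * (2 / delta ^+ 2).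
have B0 : 0 <= B.
  by rewrite addr_ge0 ?mulr_ge0// ?invr_ge0 ?exprn_ge0// ltW.
(* Chosen so that [mu ^+ 2 = 2 * s * (B + 1)], contradicting the final bound
   [m b * m a <= 2 * s * B]. *)
pose s := mu ^+ 2 / (2 * (B + 1)).
have s0 : 0 < s by rewrite divr_gt0 ?exprn_gt0//; lra.
(* [rho / 4] keeps outside points away from every member, [1] makes [c j a] nonnegative in the
   cluster, and [s ^+ 2 / 2] forces [S < s] below. *)
exists (Num.min (Num.min (rho / 4) 1) (s ^+ 2 / 2)); split.
- by rewrite !lt_min ltr01 !divr_gt0 ?exprn_gt0.
- by rewrite !ge_min ler_pdivrMr//; apply/orP; left; apply/orP; left; lra.
move=> c a [c1 cC crange ctri cK] gap b ba.
set r := Num.min _ _ in gap *; rewrite leNgt; apply/negP => br.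
have rrho : r <= rho / 4 by rewrite /r !ge_min lexx.
have r1 : r <= 1 by rewrite /r !ge_min lexx orbT.
have rs : r <= s ^+ 2 / 2 by rewrite /r !ge_min lexx orbT.
have c_le1 i j : c i j <= 1.
  by have [->|/crange/andP[_ /ltW//]] := eqVneq i j; rewrite c1.
have c_geN1 i j : -1 <= c i j.
  have [->|/crange/andP[+ _]] := eqVneq i j; first by rewrite c1; lra.
  by move=> ?; lra.
pose P i := 1 - c i a < rho.
have aP : P a by rewrite /P c1 subrr.
have bP : P b by rewrite /P; lra.
have D_ge0 i j : 0 <= 1 - c i j ^+ 2.
  have := c_le1 i j; have := c_geN1 i j; move: (c i j) => u; nra.
(* The extra factor [m i] makes the weights symmetric. *)
pose w i j := m i * (m j / (1 - c i j ^+ 2) `^ (3 / 2)).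
have w_ge0 i j : 0 <= w i j by rewrite /w !mulr_ge0 ?invr_ge0 ?powR_ge0// ltW.
have wC i j : w i j = w j i by rewrite /w (cC i j) mulrCA mulrA.
pose F i j := w i j * (c j a - c i j * c i a).
have total : \sum_(i | P i) \sum_j F i j <= M * K.
  apply: (@le_trans _ _ (\sum_(i | P i) m i * K)); last first.
    by rewrite /M mulr_suml; apply: ler_sum_cond => i; rewrite mulr_ge0// ltW.
  apply: ler_sum => i _.
  have -> : \sum_j F i j = m i *
      \sum_j m j / (1 - c i j ^+ 2) `^ (3 / 2) * (c j a - c i j * c i a).
    by rewrite mulr_sumr; apply: eq_bigr => j _; rewrite /F /w -!mulrA.
  by rewrite ler_pM2l// (le_trans (ler_norm _))// cK.
have ext : - (M * M * (2 / delta ^+ 2)) <= \sum_(i | P i) \sum_(j | ~~ P j) F i j.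
  have FE i j : P i -> ~~ P j -> - (m i * m j * (2 / delta ^+ 2)) <= F i j.
    move=> Pi nPj.
    have ij : i != j by apply: contraNneq nPj => <-.
    have /andP[cl _] := crange _ _ ij.
    have Pi' := gap _ Pi.
    have Pj' : rho <= 1 - c j a by rewrite leNgt.
    have tri := ctri i j a.
    have gij : rho / 4 <= 1 - c i j by lra.
    have dD : delta <= 1 - c i j ^+ 2.
      have -> : 1 - c i j ^+ 2 = (1 - c i j) * (1 + c i j) by ring.
      by rewrite ler_pM ?divr_ge0 ?(ltW rho0) ?(ltW eps0)//; lra.
    have D1 : 1 - c i j ^+ 2 <= 1 by rewrite gerBl sqr_ge0.
    (* The base is at most 1, so the exponent 3/2 may be raised to 2. *)
    have Dpow : delta ^+ 2 <= (1 - c i j ^+ 2) `^ (3 / 2).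
      apply: (@le_trans _ _ ((1 - c i j ^+ 2) ^+ 2)).
        by rewrite ler_sqr ?nnegrE// ?ltW.
      have D01 : 0 < 1 - c i j ^+ 2 <= 1 by rewrite D1 andbT (lt_le_trans delta0).
      by rewrite -[leLHS]powR_mulrn//; apply: (ger_powR D01); lra.
    have inv_le : ((1 - c i j ^+ 2) `^ (3 / 2))^-1 <= (delta ^+ 2)^-1.
      by rewrite lef_pV2 ?posrE ?exprn_gt0// (lt_le_trans _ Dpow)// exprn_gt0.
    have x2 : - 2 <= c j a - c i j * c i a.
      have := c_geN1 j a; have := c_geN1 i j; have := c_le1 i j.
      have := c_geN1 i a; have := c_le1 i a.
      move: (c j a) (c i j) (c i a) => u v z; nra.
    have w_le : w i j <= m i * m j * (delta ^+ 2)^-1.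
      by rewrite /w mulrA ler_wpM2l// mulr_ge0// ltW.
    have w0 := w_ge0 i j; rewrite /F; move: (w i j) (c j a - _) w0 w_le x2 => u v.
    move: (m i * m j) (_^-1) => p q; rewrite mulrA => *; nra.
  have mm0 i j : 0 <= m i * m j * (2 / delta ^+ 2).
    by rewrite !mulr_ge0 ?invr_ge0 ?exprn_ge0// ltW.
  have -> : M * M * (2 / delta ^+ 2) = \sum_i \sum_j m i * m j * (2 / delta ^+ 2).
    rewrite /M !mulr_suml; apply: eq_bigr => i _.
    by rewrite mulr_sumr mulr_suml.
  rewrite lerNl -sumrN.
  apply: le_trans (ler_sum_cond P _) => [|i]; last exact: sumr_ge0.
  apply: ler_sum => i Pi; rewrite -sumrN.
  apply: le_trans (ler_sum_cond (fun j => ~~ P j) (mm0 i)).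
  by apply: ler_sum => j nPj; rewrite lerNl; exact: FE.
have int_ge : w b a * (1 - c b a) <=
    \sum_(i | P i) \sum_(j | P j) F i j.
  rewrite symmetric_force_sum//.
  (* After symmetrization every term is nonnegative, so the term of [b] and [a] alone is a lower
     bound. *)
  have t0 i j : P j -> 0 <= w i j * (1 - c i j) * c j a.
    move=> Pj; have cj0 : 0 <= c j a by have := gap _ Pj; lra.
    by rewrite (mulr_ge0 (mulr_ge0 (w_ge0 i j) _))// subr_ge0.
  rewrite (bigD1 b)//= (bigD1 a)//= c1 mulr1 -addrA lerDl addr_ge0//.
    by apply: sumr_ge0 => j /andP[Pj _]; exact: t0.
  by apply: sumr_ge0 => i _; apply: sumr_ge0 => j; exact: t0.
have wB : w b a * (1 - c b a) <= B.
  apply: (le_trans int_ge).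
  have : \sum_(i | P i) \sum_j F i j = \sum_(i | P i) \sum_(j | P j) F i j +
      \sum_(i | P i) \sum_(j | ~~ P j) F i j.
    by rewrite -big_split/=; apply: eq_bigr => i _; rewrite (bigID P).
  by move=> /esym/(canRL (addrK _)) ->; rewrite /B lerD// lerNl.
have x1 : c b a < 1 by have /andP[] := crange _ _ ba.
have xN1 : - 1 < c b a by have /andP[] := crange _ _ ba; lra.
set x := c b a in br wB x1 xN1.
have DE : 1 - x ^+ 2 = (1 - x) * (1 + x) by ring.
have D0 : 0 < 1 - x ^+ 2 by rewrite DE mulr_gt0; lra.
pose S := Num.sqrt (1 - x ^+ 2).
have S0 : 0 < S by rewrite sqrtr_gt0.
have Ss : S < s.
  by rewrite -ltr_sqr ?nnegrE ?ltW// sqr_sqrtr ?ltW// DE; nra.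
(* The denominator in [w b a] factors as [(1 - x) * (1 + x) * S]. *)
have mmE : m b * m a = w b a * (1 - x) * ((1 + x) * S).
  rewrite /w -/x powR32E ?ltW// -/S DE; field.
  by rewrite !gt_eqF//; lra.
have mu2 : mu ^+ 2 = s * (2 * (B + 1)).
  by rewrite /s divfK// gt_eqF//; lra.
have mumm : mu ^+ 2 <= m b * m a by rewrite expr2 ler_pM ?(ltW mu0).
have S2 : (1 + x) * S <= 2 * s by apply: ler_pM; [lra|exact: ltW|lra|exact: ltW].
have : w b a * (1 - x) * ((1 + x) * S) <= B * (2 * s).
  apply: ler_pM => //; last by rewrite mulr_ge0 ?ltW//; lra.
  by rewrite mulr_ge0//; lra.
by rewrite -mmE; move: mumm mu2 s0; clear; lra.
Qed.

Lemma bounded_force_separation (R : realType) (n : nat) (m : 'I_n -> R) (eps K : R) :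
  (forall i, 0 < m i) -> 0 < eps -> 0 <= K ->
  exists2 r, 0 < r & forall c, bounded_force_gram m eps K c ->
    forall a b, b != a -> r <= 1 - c b a.
Proof.
move=> m0 eps0 K0.
(* Induction on the number of points within [rho] of [a], with [a] itself counted. *)
suff H N : forall rho : R, 0 < rho -> exists2 r : R, 0 < r & forall c,
    bounded_force_gram m eps K c -> forall a,
    (#|[pred i | (1 - c i a < rho)%R]| <= N.+1)%N -> forall b, b != a -> r <= 1 - c b a.
  have [r r0 rH] := H n 1 ltr01.
  exists r => // c cm a; apply: rH => //.
  by rewrite (leq_trans (max_card _))// card_ord.
elim: N => [|N IH] rho rho0.
  exists rho => // c [c1 _ _ _ _] a C1 b ba; rewrite leNgt; apply: contraL C1 => brho.
  rewrite -ltnNge (cardD1 a) (cardD1 b) !inE/= ba brho c1 subrr rho0.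
  by [].
have [r [r0 rrho rH]] := cluster_gap m0 eps0 K0 rho0.
have [s s0 sH] := IH _ r0.
exists (Num.min r s); first by rewrite lt_min r0.
move=> c cm a CN b ba; rewrite ge_min.
(* Either the shell between [r] and [rho] is empty, or shrinking to [r] loses a point. *)
have [/forallP allr|] := boolP [forall i, (1 - c i a < rho) ==> (1 - c i a < r)].
  by rewrite (rH _ _ cm _ _ ba)// => i; exact/implyP/allr.
rewrite negb_forall => /existsP[i]; rewrite negb_imply => /andP[irho ir].
apply/orP; right; apply: sH => //; rewrite -ltnS; apply: leq_trans CN.
apply/proper_card/properP; split.
  by apply/fintype.subsetP => j; rewrite !inE => /lt_le_trans; exact.
by exists i; rewrite !inE.
Qed.

(** * Force bounds for relative equilibria *)

Lemma enorm_le_edot (R : realType) (d : nat) (x y : 'cV[R]_d) (K : R) :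
  enorm x <= K -> edot y y = 1 -> `|edot x y| <= K.
Proof.
move=> xK y1; have K0 : 0 <= K by rewrite (le_trans _ xK)// sqrtr_ge0.
apply: edot_le => //; rewrite -[leLHS]sqr_sqrtr ?edot_ge0//.
by rewrite ler_sqr ?nnegrE// sqrtr_ge0.
Qed.

(** The force is [f + s *: q i t]; each summand contributes at most [c2] along a unit vector. *)
Lemma releq_bounded_force_gram (R : realType) (n k : nat) (m : 'I_n -> R)
    (I : set R) (T : R -> 'M[R]_k.+1) :
  admissible 1 I T -> exists2 K, 0 <= K & forall eps q, releq_set m I T eps q ->
    forall t, I t -> bounded_force_gram m eps K (fun i j => edot (q i t) (q j t)).
Proof.
move=> [[oI _ _] [dT _] [c1 [c2 [_ c2_gt0 Tbound]]] isoT _].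
exists (2 * c2); first by rewrite mulr_ge0// ltW.
move=> eps q [Q [[[_ Mq den_gt0 motion] qE] Qeps]] t It.
have TT : (T t)^T *m T t = 1%:M by apply: isometry_trmx_mul => x y; exact: isoT.
have dotQ i j : edot (q i t) (q j t) = edot (Q i) (Q j).
  by rewrite !qE// edot_isometry.
have q1 i : edot (q i t) (q i t) = 1 by apply/Mspace1E; exact: Mq.
have den i j : nbody_den 1 (q i t) (q j t) = 1 - edot (q i t) (q j t) ^+ 2.
  by rewrite /nbody_den mul1r odot1E.
split => //.
- by move=> i j; exact: edotC.
- move=> i j ij; rewrite {1}dotQ Qeps//=.
  have := den_gt0 i j t It; rewrite eq_sym den => /(_ ij) D0.
  by rewrite ltNge; apply/negP => x1; nra.
- by move=> i j a; exact: edot_unit_triangle.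
move=> i a.
pose s := edot (derive1 (q i) t) (derive1 (q i) t).
pose f := derive1n 2 (q i) t.
have forceE (z : 'cV[R]_k.+1) : edot f z + s * edot (q i t) z =
    \sum_j m j / (1 - edot (q i t) (q j t) ^+ 2) `^ (3 / 2) *
      (edot (q j t) z - edot (q i t) (q j t) * edot (q i t) z).
  rewrite /f motion// /nbody_rhs edotBl edotZl mul1r odot1E -/s subrK edot_suml.
  (* The term [j = i] vanishes through its second factor. *)
  rewrite [RHS](bigD1 i)//= q1 mul1r subrr mulr0 add0r.
  by apply: eq_bigr => j _; rewrite edotZl edotBl edotZl mul1r odot1E den.
have f_le z : edot z z = 1 -> `|edot f z| <= c2.
  move=> z1; rewrite /f (derive1n2_mulmxr (x := Q i) oI dT)//; last by move=> u /qE.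
  apply: enorm_le_edot z1; have /andP[_] := Tbound t (Q i) It.
  rewrite [enorm (Q i)]/enorm -dotQ q1 sqrtr1 mulr1; apply: le_trans.
  have -> : invmx (T t) = (T t)^T.
    by have [_ Tu] := mulmx1_unit TT; rewrite -[LHS]mul1mx -TT mulmxK.
  rewrite le_eqVlt -mulmxA; apply/orP; left; apply/eqP.
  congr Num.sqrt; symmetry; apply: edot_isometry.
  by rewrite trmxK mulmx1C.
rewrite -forceE.
have s_le : `|s| <= c2.
  (* The force is tangent to the sphere, so pairing with [q i t] leaves [s = - edot f (q i t)]. *)
  have := forceE (q i t); rewrite q1 mulr1 big1 => [|j _].
    by move/eqP; rewrite addrC addr_eq0 => /eqP ->; rewrite normrN f_le.
  by rewrite mulr1 [edot (q j t) _]edotC subrr mulr0.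
have qq : `|edot (q i t) (q a t)| <= 1 by apply: edot_le; rewrite ?expr1n ?q1.
rewrite (le_trans (ler_normD _ _))// normrM.
have := f_le _ (q1 a); have := normr_ge0 s; move: s_le qq (normr_ge0 (edot (q i t) (q a t))).
move: `|s| `|edot (q i t) _| `|edot f _| => u v x *; nra.
Qed.

Theorem theorem1p6 (R : realType) (n k : nat) (hn : (2 <= n)%N) (hk : (2 <= k)%N)
    (m : 'I_n -> R) (hm : forall i, 0 < m i)
    (I : set R) (T : R -> 'M[R]_k.+1) (hT : admissible 1 I T) :
  forall eps : R, 0 < eps ->
    exists c : R, 0 < c /\
      forall q, releq_set m I T eps q ->
        forall t, I t -> forall i j : 'I_n, i != j ->
          enorm (q i t - q j t) > c.
Proof.
move=> eps eps0; have [K K0 gramK] := releq_bounded_force_gram m hT.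
have [r r0 rP] := bounded_force_separation hm eps0 K0.
(* The squared chord is at least [2 * r], hence strictly above [r]. *)
exists (Num.sqrt r); split; first by rewrite sqrtr_gt0.
move=> q qR t It i j ij; have gram := gramK _ _ qR t It.
have rij := rP _ gram j i ij; case: gram => q1 _ _ _ _.
rewrite ltr_sqrt edot_subsq ?q1; lra.
Qed.
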